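(* Let $(i,j)$ be any pair of players that is schedule-equivalent and such that either (A) the schedule is venue-balanced for $i$ and for $j$, or (B) the model is venue-neutral. Then the skill order of $i$ and $j$, which is their score order, i.e. $$s_i\ge s_j\iff\hat\theta_i\ge\hat\theta_j,$$ does not depend on (i) the choice of a strictly increasing function $\tilde G(\cdot)$ in the estimating equation given in the context, and hence on the intercepts and, under the home-boost model, on the home advantage $\eta$; (ii) the replacement of the Gaussian (ridge) prior by any log-concave prior $\prod_m f(\theta_m)$; or (iii) the presence of the prior: the maximum likelihood estimate ($\gamma=0$) gives the same order whenever it is finite.
   Context: Players $1,\dots,M$ with real skills $\theta_1,\dots,\theta_M$ play one-on-one matches, each having a host and a visitor. Outcomes lie in $\{0,\dots,L-1\}$ and are ordered; if the host's outcome is $y$, the visitor's is $L-1-y$. Counts. $k^{\mathrm h}_{y;i,j}$ is the number of matches hosted by $i$ against $j$ that ended in $i$'s outcome $y$; $k^{\mathrm a}_{y;i,j}=k^{\mathrm h}_{L-1-y;j,i}$ is the number of matches in which $i$ visited $j$ with $i$'s outcome $y$; $k_{y;i}=\sum_j(k^{\mathrm h}_{y;i,j}+k^{\mathrm a}_{y;i,j})$; $k^{\mathrm h}_{i,j}=\sum_yk^{\mathrm h}_{y;i,j}$; $k^{\mathrm a}_{i,j}=k^{\mathrm h}_{j,i}$; $k_{i,j}=k^{\mathrm h}_{i,j}+k^{\mathrm a}_{i,j}$; $d_{i,j}=k^{\mathrm h}_{i,j}-k^{\mathrm a}_{i,j}=-d_{j,i}$. Schedule conditions. The pair $(i,j)$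 is schedule-equivalent if $k_{i,l}=k_{j,l}$ for all $l\ne i,j$. The schedule is venue-balanced for player $i$ if $k^{\mathrm h}_{i,l}=k^{\mathrm a}_{i,l}$ for every $l$, i.e. $d_{i,l}=0$ for every $l$. Adjacent categories model with constant-sum slopes. When $i$ hosts $j$, $i$'s outcome is $y$ with probability $\mathsf{P}^{\mathrm h}_y(\theta_i-\theta_j)$, where $$\mathsf{P}^{\mathrm h}_y(z)=\frac{e^{\alpha^{\mathrm h}_y+\delta_yz}}{\sum_{l=0}^{L-1}e^{\alpha^{\mathrm h}_l+\delta_lz}},$$ with real intercepts $\alpha^{\mathrm h}_y$ and non-decreasing slopes $\delta_y$ with $\delta_0=0$, $\delta_{L-1}=1$ and $\delta_y+\delta_{L-1-y}=1$ for all $y$. When $i$ visits $j$, $i$'s outcome is $y$ with probability $\mathsf{P}^{\mathrm a}_y(\theta_i-\theta_j)$, where $\mathsf{P}^{\mathrm a}_y(z)=\mathsf{P}^{\mathrm h}_{L-1-y}(-z)$. The model is venue-neutral (no home advantage) if $\mathsf{P}^{\mathrm h}_y=\mathsf{P}^{\mathrm a}_y$ for all $y$. The home-boost model has $\alpha^{\mathrm h}_y=\alpha_y+\delta_y\eta$ with symmetric intercepts $\alpha_y=\alpha_{L-1-y}$ and home advantage $\eta$. The score-points are the slopes, so the score of player $i$ is $s_i=\sum_y\delta_yk_{y;i}$; the score order is the order of the $s_i$. Estimates. The MAP estimate $\hat{\boldsymbol\theta}$ maximizes $\sum_{i,j}\sum_yk^{\mathrm h}_{y;i,j}\log\mathsf{P}^{\mathrm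 h}_y(\theta_i-\theta_j)+\sum_i\log f(\theta_i)$ over $\boldsymbol\theta$, with, by default, the Gaussian (ridge) prior $\log f(\theta)=-\tfrac{\gamma}{2}\theta^2+\mathrm{const}$, $\gamma>0$. The maximum likelihood estimate corresponds to no prior ($\gamma=0$). The skill order is the order of the estimates $\hat\theta_i$. Estimating equation. Let $G^{\mathrm h}(z)=\sum_l\delta_l\mathsf{P}^{\mathrm h}_l(z)$ and $G^{\mathrm a}(z)=\sum_l\delta_l\mathsf{P}^{\mathrm a}_l(z)$ be the expected scores, and $\tilde G=\tfrac12(G^{\mathrm h}+G^{\mathrm a})$, $\check G=\tfrac12(G^{\mathrm h}-G^{\mathrm a})$; $\tilde G$ is strictly increasing, and $\check G\equiv0$ under a venue-neutral model. With the Gaussian prior, $\hat{\boldsymbol\theta}$ satisfies, for every player $m$, $$\sum_{l\ne m}\bigl[k_{m,l}\,\tilde G(\hat\theta_m-\hat\theta_l)+d_{m,l}\,\check G(\hat\theta_m-\hat\theta_l)\bigr]+\gamma\hat\theta_m=s_m.$$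
   Formalization: In (ii) the equivalence needs f differentiable at the estimate (a Laplace prior is a counterexample; score order still implies skill order for all log-concave f) and that i plays a match or the MAP is unique; in (iii) i must play a match, as otherwise the estimate is undetermined. *)

(* Defs.v *)
From HB Require Import structures.
From mathcomp Require Import all_boot all_order all_algebra.
From mathcomp Require Import all_classical all_reals all_analysis.
Import Order.TTheory GRing.Theory Num.Theory.
Import numFieldNormedType.Exports.

Set Implicit Arguments.
Unset Strict Implicit.
Unset Printing Implicit Defensive.

Local Open Scope ring_scope.

(* Players are 'I_M and outcomes 'I_L; the reversed outcome L-1-y is rev_ord y.
   The data are the numbers kh y i j of matches hosted by i against j that ended
   with outcome y for i. *)
Section Counts.
Variables (M L : nat) (kh : 'I_L -> 'I_M -> 'I_M -> nat).

Definition no_self_match : Prop := forall y i, kh y i i = 0%N.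

Definition ka (y : 'I_L) (i j : 'I_M) : nat := kh (rev_ord y) j i.

Definition outcome_count (y : 'I_L) (i : 'I_M) : nat :=
  (\sum_(j < M) (kh y i j + ka y i j))%N.

Definition kh_tot (i j : 'I_M) : nat := (\sum_(y < L) kh y i j)%N.
Definition ka_tot (i j : 'I_M) : nat := kh_tot j i.
Definition k_tot (i j : 'I_M) : nat := (kh_tot i j + ka_tot i j)%N.
Definition d_tot (i j : 'I_M) : int := (kh_tot i j)%:Z - (ka_tot i j)%:Z.

Definition schedule_equivalent (i j : 'I_M) : Prop :=
  forall l, l != i -> l != j -> k_tot i l = k_tot j l.

Definition venue_balanced (i : 'I_M) : Prop :=
  forall l, kh_tot i l = ka_tot i l.

Definition plays (i : 'I_M) : Prop := exists l, (0 < k_tot i l)%N.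

End Counts.

Section Model.
Variables (R : realType) (L : nat).

Definition constant_sum_slopes (delta : 'I_L -> R) : Prop :=
  [/\ forall y y' : 'I_L, (y <= y')%N -> delta y <= delta y',
      forall y : 'I_L, (y : nat) = 0%N -> delta y = 0,
      forall y : 'I_L, (y : nat) = L.-1 -> delta y = 1
    & forall y : 'I_L, delta y + delta (rev_ord y) = 1].

Variables (ah delta : 'I_L -> R).

Definition Ph (y : 'I_L) (z : R) : R :=
  expR (ah y + delta y * z) / \sum_(l < L) expR (ah l + delta l * z).

Definition Pa (y : 'I_L) (z : R) : R := Ph (rev_ord y) (- z).

Definition venue_neutral : Prop := forall y z, Ph y z = Pa y z.

Definition Gh (z : R) : R := \sum_(l < L) delta l * Ph l z.
Definition Ga (z : R) : R := \sum_(l < L) delta l * Pa l z.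
Definition Gcheck (z : R) : R := (Gh z - Ga z) / 2.

End Model.

Definition symmetric_intercepts (R : realType) (L : nat) (a : 'I_L -> R) : Prop :=
  forall y, a y = a (rev_ord y).

Definition home_boost (R : realType) (L : nat) (a delta : 'I_L -> R) (eta : R) :
  'I_L -> R := fun y => a y + delta y * eta.

Section Estimates.
Variables (R : realType) (M L : nat) (kh : 'I_L -> 'I_M -> 'I_M -> nat).
Variables (ah delta : 'I_L -> R).

Definition score (i : 'I_M) : R :=
  \sum_(y < L) delta y * (outcome_count kh y i)%:R.

Definition loglik (th : 'I_M -> R) : R :=
  \sum_(i < M) \sum_(j < M) \sum_(y < L)
    (kh y i j)%:R * ln (Ph ah delta y (th i - th j)).

Definition log_posterior (f : R -> R) (th : 'I_M -> R) : R :=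
  loglik th + \sum_(i < M) ln (f (th i)).

(* The library has ln 0 = 0, whereas a vanishing prior density stands for a
   log-density of -oo: maximization is over the points of positive density. *)
Definition is_MAP (f : R -> R) (th : 'I_M -> R) : Prop :=
  (forall m, 0 < f (th m)) /\
  (forall th' : 'I_M -> R, (forall m, 0 < f (th' m)) ->
     log_posterior f th' <= log_posterior f th).

(* A maximizer over R^M, i.e. a finite maximum likelihood estimate. *)
Definition is_ML (th : 'I_M -> R) : Prop :=
  forall th' : 'I_M -> R, loglik th' <= loglik th.

Definition estimating_equation (Gt Gc : R -> R) (gamma : R) (th : 'I_M -> R) : Prop :=
  forall m, \sum_(l < M | l != m)
      ((k_tot kh m l)%:R * Gt (th m - th l) + (d_tot kh m l)%:~R * Gc (th m - th l))
    + gamma * th m = score m.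

Definition balanced_or_neutral (i j : 'I_M) : Prop :=
  (venue_balanced kh i /\ venue_balanced kh j) \/ venue_neutral ah delta.

End Estimates.

Section Priors.
Variable R : realType.

Definition gaussian_prior (gamma : R) (f : R -> R) : Prop :=
  exists c : R, forall x, f x = expR (- (gamma / 2) * x ^+ 2 + c).

(* Log-concavity of a density that may vanish: log f is concave with values in
   R or -oo. *)
Definition log_concave (f : R -> R) : Prop :=
  (forall x, 0 <= f x) /\
  (forall x y t : R, 0 < t -> t < 1 ->
     f x `^ t * f y `^ (1 - t) <= f (t * x + (1 - t) * y)).

End Priors.

(* Main.v *)
(* The log-likelihood is a linear form with coefficients s_m - k_m/2, where k_m is
   the number of matches of m, minus a convex penalty which is invariant under
   exchanging theta_i and theta_j.  Hence the exchange changes the log-posterior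
   by (s_i - s_j)(theta_j - theta_i), and optimality gives
   (s_i - s_j)(theta_i - theta_j) >= 0.  If s_i = s_j, the exchanged point is also
   a maximizer, so strict concavity (or uniqueness) gives theta_i = theta_j.  If
   theta_i = theta_j, the log-posterior along e |-> theta + e (u_i - u_j) is
   (s_i - s_j) e plus an even function of e, so a smooth maximum forces
   s_i = s_j. *)
Require Import Defs.
From HB Require Import structures.
From mathcomp Require Import all_boot all_order all_algebra all_fingroup.
From mathcomp Require Import all_classical all_reals all_analysis.
From mathcomp Require Import ring lra.
Import Order.TTheory GRing.Theory Num.Theory.
Import numFieldNormedType.Exports.

Set Implicit Arguments.
Unset Strict Implicit.

Local Open Scope ring_scope.

(** * Strict Cauchy-Schwarz inequality for finite sums *)

Section CauchySchwarz.
Variables (R : realDomainType) (I : finType) (u v : I -> R).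

(** Lagrange's identity; the factor 2 comes from summing over ordered pairs. *)
Lemma sum_cross_sqr :
  \sum_l \sum_m (u l * v m - u m * v l) ^+ 2 =
  2 * ((\sum_l u l ^+ 2) * (\sum_l v l ^+ 2) - (\sum_l u l * v l) ^+ 2).
Proof.
transitivity (\sum_l \sum_m (u l ^+ 2 * v m ^+ 2 + v l ^+ 2 * u m ^+ 2
    - 2 * (u l * v l * (u m * v m)))).
  by apply: eq_bigr => l _; apply: eq_bigr => m _; ring.
under eq_bigr do rewrite sumrB big_split /= -!mulr_sumr.
rewrite sumrB big_split /= -!mulr_sumr -!mulr_suml; ring.
Qed.

Lemma strict_Cauchy_Schwarz (a b : I) : u a * v b != u b * v a ->
  (\sum_l u l * v l) ^+ 2 < (\sum_l u l ^+ 2) * (\sum_l v l ^+ 2).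
Proof.
move=> hab; rewrite -subr_gt0 -(pmulr_rgt0 _ (ltr0Sn R 1)) -sum_cross_sqr.
rewrite (bigD1 a) //= (bigD1 b) //= -addrA ltr_wpDr //.
  by rewrite addr_ge0 ?sumr_ge0 // => l _; rewrite ?sqr_ge0 ?sumr_ge0 // => m _;
     rewrite sqr_ge0.
by rewrite lt_neqAle sqr_ge0 eq_sym sqrf_eq0 subr_eq0 hab.
Qed.

End CauchySchwarz.

(** * The log-likelihood and its behaviour under the exchange of two players *)

Section Likelihood.
Variables (R : realType) (L : nat) (ah delta : 'I_L -> R).
Hypotheses (hL : (1 < L)%N) (hdelta : constant_sum_slopes delta).

Definition partition_function (z : R) : R := \sum_(l < L) expR (ah l + delta l * z).
Local Notation Z := partition_function.

Lemma partition_function_gt0 z : 0 < Z z.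
Proof.
rewrite /Z (bigD1 (Ordinal (ltnW hL))) //= ltr_pwDl ?expR_gt0 //.
by rewrite sumr_ge0 // => l _; rewrite expR_ge0.
Qed.

Lemma ln_Ph y z : ln (Ph ah delta y z) = ah y + delta y * z - ln (Z z).
Proof. by rewrite ln_div ?posrE ?expR_gt0 ?partition_function_gt0// expRK. Qed.

(** Strict convexity of [ln Z], from Cauchy-Schwarz on the square roots [u] of the terms of [Z]. It
    is strict because the first and last outcomes have distinct slopes 0 and 1, so the vectors at
    [x] and [y] are not proportional. *)
Lemma ln_partition_midpoint x y : x != y ->
  2 * ln (Z ((x + y) / 2)) < ln (Z x) + ln (Z y).
Proof.
move=> hxy; have Zgt0 := partition_function_gt0.
rewrite -lnM ?posrE// mulr_natl -lnXn// ltr_ln ?posrE ?exprn_gt0 ?mulr_gt0//.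
pose u w l := expR ((ah l + delta l * w) / 2).
have uE w : Z w = \sum_l u w l ^+ 2.
  by apply: eq_bigr => l _; rewrite /u expr2 -expRD; congr expR; field.
have -> : Z ((x + y) / 2) = \sum_l u x l * u y l.
  by apply: eq_bigr => l _; rewrite /u -expRD; congr expR; field.
rewrite !uE; have hL1 : (L.-1 < L)%N by case: L hL.
apply: (@strict_Cauchy_Schwarz _ _ _ _ (Ordinal (ltnW hL)) (Ordinal hL1)).
case: hdelta => _ d0 d1 _; rewrite /u -!expRD.
apply: contra hxy => /eqP/expR_inj; rewrite d0// d1// => h.
by apply/eqP; lra.
Qed.

Lemma ln_Ph_midpoint_lt y z z' : z != z' ->
  ln (Ph ah delta y z) + ln (Ph ah delta y z') < 2 * ln (Ph ah delta y ((z + z') / 2)).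
Proof. by move=> /ln_partition_midpoint; rewrite !ln_Ph; lra. Qed.

Lemma ln_Ph_midpoint y z z' :
  ln (Ph ah delta y z) + ln (Ph ah delta y z') <= 2 * ln (Ph ah delta y ((z + z') / 2)).
Proof.
have [->|/ln_Ph_midpoint_lt/ltW//] := eqVneq z z'.
by rewrite (_ : (z' + z') / 2 = z') ?mulr2n ?mulrDl ?mul1r//; field.
Qed.

(* Subtracting z / 2 makes it even under a venue-neutral model. *)
Definition centred_log_partition (z : R) : R := ln (Z z) - z / 2.
Local Notation A := centred_log_partition.

(** Neutrality at outcome 0, whose reverse has slope 1, relates [Z z] to [Z (- z)]. Its instance at
    0 equates the two extreme intercepts. *)
Lemma venue_neutral_even : venue_neutral ah delta -> forall z, A (- z) = A z.
Proof.
move=> vn z; pose o := Ordinal (ltnW hL).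
have h w : ln (Ph ah delta o w) = ln (Ph ah delta (rev_ord o) (- w)) by rewrite vn.
have h0 := h 0; have hz := h z.
case: hdelta => _ d0 _ /(_ o) d1; rewrite !ln_Ph in h0 hz.
have e0 : delta o = 0 by rewrite d0.
rewrite /A; move: h0 hz d1; rewrite e0 oppr0 !mulr0 add0r => h0 hz d1.
by rewrite d1 in hz; lra.
Qed.

Section Schedule.
Variables (M : nat) (kh : 'I_L -> 'I_M -> 'I_M -> nat).

Lemma k_totC a b : k_tot kh a b = k_tot kh b a.
Proof. by rewrite /k_tot /ka_tot addnC. Qed.

Definition matches (a : 'I_M) : R := \sum_l (k_tot kh a l)%:R.

Definition penalty (th : 'I_M -> R) : R :=
  \sum_a \sum_b (kh_tot kh a b)%:R * A (th a - th b).

(** By the constant sum, a visitor whose host has outcome [y] scores [1 - delta y]; the units add up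
    to the number of away matches. *)
Lemma scoreE a : score kh delta a =
  \sum_b (\sum_y (kh y a b)%:R * delta y - \sum_y (kh y b a)%:R * delta y
          + (kh_tot kh b a)%:R).
Proof.
rewrite /score.
under eq_bigr do rewrite /outcome_count natr_sum mulr_sumr.
rewrite exchange_big /=; apply: eq_bigr => b _.
under eq_bigr do rewrite natrD mulrDr.
rewrite big_split /= -addrA; congr (_ + _).
  by apply: eq_bigr => y _; rewrite mulrC.
rewrite (reindex_inj rev_ord_inj) /= addrC /kh_tot natr_sum -sumrB.
apply: eq_bigr => y _; rewrite /ka rev_ordK.
case: hdelta => _ _ _ /(_ y) h.
by rewrite (_ : delta (rev_ord y) = 1 - delta y); [ring | lra].
Qed.

Lemma sum_diff (X : 'I_M -> 'I_M -> R) (t : 'I_M -> R) :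
  \sum_a \sum_b X a b * (t a - t b) = \sum_a (\sum_b (X a b - X b a)) * t a.
Proof.
under eq_bigr do under eq_bigr do rewrite mulrBr.
under eq_bigr do rewrite sumrB.
rewrite sumrB [X in _ - X]exchange_big -sumrB /=.
by apply: eq_bigr => a _; rewrite -sumrB mulr_suml; apply: eq_bigr => b _; rewrite mulrBl.
Qed.

Lemma loglikE th : loglik kh ah delta th =
  \sum_a \sum_b \sum_y (kh y a b)%:R * ah y
  + \sum_a (score kh delta a - matches a / 2) * th a - penalty th.
Proof.
(* Each match moves z / 2 from [ln (Z z)] to the linear part, which leaves slope [delta y] - 1/2
   there and [A] in the penalty. *)
pose X a b : R := \sum_y (kh y a b)%:R * delta y - (kh_tot kh a b)%:R / 2.
transitivity (\sum_a \sum_b \sum_y (kh y a b)%:R * ah y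
    + \sum_a \sum_b X a b * (th a - th b) - penalty th); last first.
  congr (_ + _ - _); rewrite sum_diff; apply: eq_bigr => a _; congr (_ * _).
  rewrite scoreE /matches mulr_suml -sumrB; apply: eq_bigr => b _.
  by rewrite /X /k_tot natrD /ka_tot; field.
rewrite /loglik /penalty -big_split -sumrB /=; apply: eq_bigr => a _.
rewrite -big_split -sumrB /=; apply: eq_bigr => b _.
under eq_bigr do rewrite ln_Ph mulrBr mulrDr.
rewrite sumrB big_split /= -mulr_suml /X /kh_tot natr_sum -/A /centred_log_partition.
under [X in _ + X - _]eq_bigr do rewrite mulrA.
by rewrite -mulr_suml; field.
Qed.

Variables i j : 'I_M.
Hypotheses (hkh : no_self_match kh) (hij : schedule_equivalent kh i j).

Lemma kh_tot_diag a : kh_tot kh a a = 0%N.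
Proof. by rewrite /kh_tot big1 // => y _; rewrite hkh. Qed.

Lemma k_tot_tperm a b : k_tot kh (tperm i j a) (tperm i j b) = k_tot kh a b.
Proof.
have diag c : k_tot kh c c = 0%N by rewrite /k_tot /ka_tot kh_tot_diag.
case: tpermP => [->|->|/eqP ai /eqP aj];
  case: tpermP => [->|->|/eqP bi /eqP bj]; rewrite ?diag //.
- by rewrite k_totC.
- by rewrite hij.
- by rewrite k_totC.
- by rewrite hij.
- by rewrite ![k_tot _ a _]k_totC hij.
- by rewrite ![k_tot _ a _]k_totC hij.
Qed.

Lemma matches_eq : matches i = matches j.
Proof.
rewrite /matches [RHS](reindex_inj (@perm_inj _ (tperm i j))) /=.
by apply: eq_bigr => l _; rewrite -[in LHS]k_tot_tperm tpermL.
Qed.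

Hypothesis hAB : balanced_or_neutral kh ah delta i j.

(** Grouping the two orders of each pair gives weights [W], and these are invariant. If [A] is even,
    [W] depends only on [k_tot]. If the schedule is balanced, the same holds for pairs that meet [i]
    or [j], and the transposition fixes all other pairs. *)
Lemma penalty_tperm th : penalty (th \o tperm i j) = penalty th.
Proof.
pose W a b z : R := (kh_tot kh a b)%:R * A z + (kh_tot kh b a)%:R * A (- z).
have WE t : 2 * penalty t = \sum_a \sum_b W a b (t a - t b).
  rewrite mulr_natl mulr2n {2}/penalty exchange_big -big_split /=.
  apply: eq_bigr => a _; rewrite -big_split /=; apply: eq_bigr => b _.
  by rewrite /W opprB.
have Wperm a b z : W (tperm i j a) (tperm i j b) z = W a b z.
  have kE c d : (kh_tot kh c d)%:R + (kh_tot kh d c)%:R = (k_tot kh c d)%:R :> R.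
    by rewrite natrD.
  case: hAB => [[vi vj]|/venue_neutral_even even]; last first.
    by rewrite /W even -!mulrDl !kE k_tot_tperm.
  have bal c d : c \in [:: i; j] -> kh_tot kh c d = kh_tot kh d c.
    by rewrite !inE => /orP[] /eqP ->; rewrite ?vi ?vj.
  have tp c : c \in [:: i; j] -> tperm i j c \in [:: i; j].
    by rewrite !inE => /orP[] /eqP ->; rewrite ?tpermL ?tpermR eqxx ?orbT.
  have WB c d : kh_tot kh c d = kh_tot kh d c ->
      W c d z = (k_tot kh c d)%:R / 2 * (A z + A (- z)).
    by move=> e; rewrite -kE /W e; field.
  have [ha|ha] := boolP (a \in [:: i; j]).
    by rewrite !WB ?k_tot_tperm// bal// tp.
  have [hb|hb] := boolP (b \in [:: i; j]).
    by rewrite !WB ?k_tot_tperm// -bal// tp.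
  move: ha hb; rewrite !inE !negb_or => /andP[ai aj] /andP[bi bj].
  by rewrite !tpermD // eq_sym.
apply: (mulfI (_ : 2 != 0 :> R)); first by [].
rewrite !WE (reindex_inj (@perm_inj _ (tperm i j))) /=.
apply: eq_bigr => a _.
rewrite (reindex_inj (@perm_inj _ (tperm i j))) /=.
by apply: eq_bigr => b _; rewrite Wperm !tpermK.
Qed.

Lemma loglik_tperm th : loglik kh ah delta (th \o tperm i j) =
  loglik kh ah delta th + (score kh delta i - score kh delta j) * (th j - th i).
Proof.
rewrite !loglikE penalty_tperm.
(* Exchanging two entries of a linear form involves only the difference of their coefficients, from
   which the match counts cancel by [matches_eq]. *)
suff : forall c : 'I_M -> R, c i - c j = score kh delta i - score kh delta j ->
  \sum_a c a * th (tperm i j a) =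
    \sum_a c a * th a + (score kh delta i - score kh delta j) * (th j - th i).
  by move=> -> /=; [ring | rewrite matches_eq; ring].
move=> c <-; have [<-|nij] := eqVneq i j.
  by rewrite subrr mul0r addr0; under eq_bigr do rewrite tperm1 perm1.
rewrite (bigD1 i) //= [in RHS](bigD1 i) //= (bigD1 j) 1?eq_sym //=.
rewrite [in RHS](bigD1 j) 1?eq_sym //= tpermL tpermR.
rewrite (eq_bigr (fun a => c a * th a)); first by ring.
by move=> a /andP[ai aj]; rewrite tpermD // eq_sym.
Qed.

End Schedule.
End Likelihood.

(** * Midpoint concavity of the log-likelihood and of the log-posterior *)

Section Concavity.
Variables (R : realType) (L : nat) (ah delta : 'I_L -> R).
Hypotheses (hL : (1 < L)%N) (hdelta : constant_sum_slopes delta).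
Variables (M : nat) (kh : 'I_L -> 'I_M -> 'I_M -> nat).

Definition midpoint (t t' : 'I_M -> R) : 'I_M -> R := fun m => (t m + t' m) / 2.

Let midpoint_diff (t t' : 'I_M -> R) a b :
  midpoint t t' a - midpoint t t' b = (t a - t b + (t' a - t' b)) / 2.
Proof. by rewrite /midpoint; field. Qed.

Let term_le t t' a b y :
  (kh y a b)%:R * ln (Ph ah delta y (t a - t b))
  + (kh y a b)%:R * ln (Ph ah delta y (t' a - t' b)) <=
  2 * ((kh y a b)%:R * ln (Ph ah delta y (midpoint t t' a - midpoint t t' b))).
Proof.
by rewrite midpoint_diff -mulrDr mulrCA ler_wpM2l// ln_Ph_midpoint.
Qed.

Lemma loglik_midpoint t t' :
  loglik kh ah delta t + loglik kh ah delta t' <=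
  2 * loglik kh ah delta (midpoint t t').
Proof.
rewrite /loglik mulr_sumr -big_split; apply: ler_sum => a _ /=.
rewrite mulr_sumr -big_split; apply: ler_sum => b _ /=.
by rewrite mulr_sumr -big_split; apply: ler_sum => y _ /=.
Qed.

(** A single match whose skill gap differs between [t] and [t'] gives one strict summand; the others
    are weakly concave. *)
Lemma loglik_midpoint_lt t t' a b : (0 < kh_tot kh a b)%N ->
  t a - t b != t' a - t' b ->
  loglik kh ah delta t + loglik kh ah delta t' <
  2 * loglik kh ah delta (midpoint t t').
Proof.
rewrite lt0n sum_nat_eq0 negb_forall => /existsP[y /= ky] ht.
rewrite /loglik mulr_sumr -big_split (bigD1 a) //= [ltRHS](bigD1 a) //=.
apply: ltr_leD; last first.
  apply: ler_sum => c _; rewrite mulr_sumr -big_split /=.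
  by apply: ler_sum => d _; rewrite mulr_sumr -big_split; apply: ler_sum => x _ /=.
rewrite mulr_sumr -big_split (bigD1 b) //= [ltRHS](bigD1 b) //=.
apply: ltr_leD; last first.
  by apply: ler_sum => d _; rewrite mulr_sumr -big_split; apply: ler_sum => x _ /=.
rewrite mulr_sumr -big_split (bigD1 y) //= [ltRHS](bigD1 y) //=.
apply: ltr_leD; last by apply: ler_sum => x _.
rewrite midpoint_diff -mulrDr mulrCA ltr_pM2l ?ltr0n ?lt0n//.
exact: ln_Ph_midpoint_lt.
Qed.

Lemma log_concave_midpoint (f : R -> R) x y : log_concave f -> 0 < f x -> 0 < f y ->
  0 < f ((x + y) / 2) /\ ln (f x) + ln (f y) <= 2 * ln (f ((x + y) / 2)).
Proof.
move=> [_ /(_ x y 2^-1)] h fx fy.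
have {h} := h; rewrite invr_gt0 invf_lt1// ltr0n ltr1n => /(_ isT isT).
rewrite (_ : 1 - 2^-1 = 2^-1 :> R); last by field.
rewrite -mulrDr [_^-1 * _]mulrC => h.
have p0 : 0 < f x `^ 2^-1 * f y `^ 2^-1 by rewrite mulr_gt0// powR_gt0.
have fm := lt_le_trans p0 h; split=> //.
move: h; rewrite -ler_ln ?posrE// lnM ?posrE ?powR_gt0// !ln_powR; lra.
Qed.

(** Two maximizers share one posterior value, which the midpoint cannot exceed. Hence the concavity
    inequalities of likelihood and prior are both equalities. *)
Lemma MAP_midpoint (f : R -> R) t t' : log_concave f ->
  is_MAP kh ah delta f t -> is_MAP kh ah delta f t' ->
  is_MAP kh ah delta f (midpoint t t') /\
  loglik kh ah delta t + loglik kh ah delta t' =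
    2 * loglik kh ah delta (midpoint t t').
Proof.
move=> fc [pt mt] [pt' mt'].
have pm m : 0 < f (midpoint t t' m) := (log_concave_midpoint fc (pt m) (pt' m)).1.
have hp : \sum_m ln (f (t m)) + \sum_m ln (f (t' m)) <=
    2 * \sum_m ln (f (midpoint t t' m)).
  rewrite mulr_sumr -big_split; apply: ler_sum => m _ /=.
  exact: (log_concave_midpoint fc (pt m) (pt' m)).2.
have hl := loglik_midpoint t t'.
have h1 := mt _ pm; have h2 := mt' _ pm; have h3 := mt _ pt'; have h4 := mt' _ pt.
rewrite /log_posterior in h1 h2 h3 h4; split; last lra.
by split=> // s ps; have := mt _ ps; rewrite /log_posterior => h5; lra.
Qed.

End Concavity.

(** * First-order condition at a local maximum, and derivability rules *)

Section LocalMaximum.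
Variable R : realType.
Local Open Scope classical_set_scope.

(** The Caratheodory slope [g] is continuous at [x]. Were [g x] nonzero, of sign [s], a small step
    from [x] in direction [s] would increase [phi]. *)
Lemma is_derive_local_max (phi : R -> R) (x d : R) :
  is_derive x 1 phi d -> (\forall z \near x, phi z <= phi x) -> d = 0.
Proof.
move=> /is_derive1_caratheodory[g [gE gc gx]] hmax; rewrite -gx.
have step (s : R) : s \in [:: 1; -1] -> s * g x <= 0.
  move=> hs; rewrite leNgt; apply/negP => gs.
  have : \forall z \near x, 0 < s * g z.
    have sc : s * g z @[z --> x] --> s * g x by apply: cvgM => //; exact: cvg_cst.
    exact: (cvgr_gt (s * g x) sc).
  move=> {}gs.
  have : nbhs x [set z | phi z <= phi x /\ 0 < s * g z] by exact: filterI.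
  move=> /nbhs_ballP[e /= e0 he].
  have /he[] : ball x e (x + s * (e / 2)).
    rewrite /ball /= opprD addrA subrr add0r normrN normrM.
    have -> : `|s| = 1 by move: hs; rewrite !inE => /orP[]/eqP->; rewrite ?normrN normr1.
    by rewrite mul1r gtr0_norm ?divr_gt0// ltr_pdivrMr// ltr_pMr// ltr1n.
  rewrite -subr_le0 gE addrAC subrr add0r => h1 h2.
  by move: h1; rewrite mulrCA mulrA pmulr_lle0 ?divr_gt0// leNgt h2.
by have := step 1; have := step (-1); rewrite !inE !eqxx ?orbT => /(_ isT) h1 /(_ isT) h2; lra.
Qed.

Lemma derivable_big_sum (n : nat) (h : 'I_n -> R -> R) (x : R) :
  (forall k, derivable (h k) x 1) -> derivable (fun z : R => \sum_k h k z) x 1.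
Proof.
move=> dh; rewrite (_ : (fun z => _) = \sum_k h k); first exact: derivable_sum.
by apply/funext => z; rewrite fct_sumE.
Qed.

Lemma derivable_affine_comp (f : R -> R) (a b x : R) :
  derivable f (a + x * b) 1 -> derivable (fun z : R => f (a + z * b)) x 1.
Proof.
by move=> /derivableP df; exact: ex_derive.
Qed.

Lemma derivable_ln_comp (f : R -> R) (x : R) :
  0 < f x -> derivable f x 1 -> derivable (fun z : R => ln (f z)) x 1.
Proof.
move=> f0 /derivableP df; apply: ex_derive.
by apply: (@is_derive1_comp _ (@ln R) f); exact: is_derive1_ln.
Qed.

End LocalMaximum.

(** * Comparison of scores and estimated skills *)

Section Order.
Variables (R : realType) (L : nat) (ah delta : 'I_L -> R).
Hypotheses (hL : (1 < L)%N) (hdelta : constant_sum_slopes delta).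
Variables (M : nat) (kh : 'I_L -> 'I_M -> 'I_M -> nat) (i j : 'I_M).
Hypotheses (hkh : no_self_match kh) (hij : schedule_equivalent kh i j).
Hypothesis hAB : balanced_or_neutral kh ah delta i j.
Local Notation s := (score kh delta).

(** The prior has the same factor for every player, so only the likelihood changes. *)
Lemma log_posterior_tperm f th :
  log_posterior kh ah delta f (th \o tperm i j) =
  log_posterior kh ah delta f th + (s i - s j) * (th j - th i).
Proof.
rewrite /log_posterior loglik_tperm// addrAC; congr (_ + _ + _).
by rewrite [RHS](reindex_inj (@perm_inj _ (tperm i j))).
Qed.

Lemma MAP_score_le f th : is_MAP kh ah delta f th ->
  0 <= (s i - s j) * (th i - th j).
Proof.
move=> [p h]; have := h _ (fun m => p (tperm i j m)).
by rewrite log_posterior_tperm; lra.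
Qed.

Lemma MAP_tie_eq f th : log_concave f -> is_MAP kh ah delta f th ->
  plays kh i \/ (forall th', is_MAP kh ah delta f th' -> th' = th) ->
  s i = s j -> th i = th j.
Proof.
move=> fc hm hu sij.
have hm' : is_MAP kh ah delta f (th \o tperm i j).
  case: hm => p h; split=> [m|t pt]; first exact: p.
  by rewrite log_posterior_tperm sij subrr mul0r addr0 h.
case: hu => [[l]|/(_ _ hm') e]; last by rewrite -[in LHS]e /= tpermL.
have [//|nij] := eqVneq (th i) (th j).
have [_ e] := MAP_midpoint hL hdelta fc hm hm'.
have [->|li] := eqVneq l i; first by rewrite /k_tot /ka_tot kh_tot_diag.
(* The exchange alters the gap between [i] and an actual opponent [l]: it changes sign if [l] is
   [j], and otherwise shifts by [th j - th i]. This contradicts the equality [e]. *)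
have ne : th i - th l != (th \o tperm i j) i - (th \o tperm i j) l.
  rewrite /= tpermL; have [->|lj] := eqVneq l j.
    by rewrite tpermR; apply: contra nij => /eqP h; apply/eqP; lra.
  rewrite tpermD 1?eq_sym//.
  by apply: contra nij => /eqP h; apply/eqP; lra.
rewrite /k_tot addn_gt0 => /orP[] k0; exfalso.
  by have := loglik_midpoint_lt ah hL hdelta k0 ne; rewrite e ltxx.
suff ne' : th l - th i != (th \o tperm i j) l - (th \o tperm i j) i.
  by have := loglik_midpoint_lt ah hL hdelta k0 ne'; rewrite e ltxx.
by rewrite -opprB -[X in _ != X]opprB eqr_opp.
Qed.

Lemma derivable_ln_Ph y z : derivable (fun w => ln (Ph ah delta y w)) z 1.
Proof.
under eq_fun do rewrite ln_Ph//.
apply: derivableB; first exact: ex_derive.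
apply: derivable_ln_comp; first exact: partition_function_gt0.
by apply: derivable_big_sum => l; exact: ex_derive.
Qed.

Lemma derivable_loglik (th u : 'I_M -> R) :
  derivable (fun e : R => loglik kh ah delta (fun m => th m + e * u m)) 0 1.
Proof.
rewrite /loglik; apply: derivable_big_sum => a; apply: derivable_big_sum => b.
apply: derivable_big_sum => y; apply: derivableM; first exact: derivable_cst.
under eq_fun do rewrite opprD addrACA -mulrBr.
apply: (@derivable_affine_comp _ (fun w => ln (Ph ah delta y w))).
exact: derivable_ln_Ph.
Qed.

(** The perturbation moves only [i] and [j], both starting from [th i], so derivability of [f] at
    this one point suffices. *)
Lemma MAP_eq_tie f th : is_MAP kh ah delta f th -> derivable f (th i) 1 ->
  th i = th j -> s i = s j.
Proof.
move=> [p h] df tij; have [->//|nij] := eqVneq i j.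
pose u m : R := (m == i)%:R - (m == j)%:R.
pose pert e m := th m + e * u m.
pose phi e := log_posterior kh ah delta f (pert e).
have u0 m : m != i -> m != j -> u m = 0.
  by rewrite /u => /negPf-> /negPf->; rewrite subrr.
(* With equal skills, exchanging the players is the same as reversing the perturbation. *)
have pert_perm e : pert e \o tperm i j = pert (- e).
  apply/funext => m; rewrite /pert /=; case: tpermP => [->|->|/eqP mi /eqP mj].
  - by rewrite tij /u !eqxx (eq_sym j i) (negPf nij); ring.
  - by rewrite tij /u !eqxx (eq_sym j i) (negPf nij); ring.
  - by rewrite u0 // !mulr0.
have phiN e : phi (- e) = phi e - 2 * (s i - s j) * e.
  rewrite /phi -pert_perm log_posterior_tperm; congr (_ + _).
  by rewrite /pert /u !eqxx (eq_sym j i) (negPf nij) tij mulr1n mulr0n; ring.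
have dfm m : u m != 0 -> derivable f (th m) 1.
  have [->//|mi] := eqVneq m i; have [->|mj] := eqVneq m j; first by rewrite -tij.
  by rewrite u0 ?eqxx.
have pert0 : pert 0 = th by apply/funext => m; rewrite /pert mul0r addr0.
have dphi : derivable phi 0 1.
  apply: derivableD; first exact: derivable_loglik.
  apply: derivable_big_sum => m.
  apply: (@derivable_ln_comp _ (fun e => f (pert e m))); first by rewrite pert0.
  have [um|/dfm dm] := eqVneq (u m) 0.
    rewrite (_ : (fun e => _) = cst (f (th m))); first exact: derivable_cst.
    by apply/funext => e; rewrite /pert um mulr0 addr0.
  by apply: derivable_affine_comp; rewrite mul0r addr0.
(* Small perturbations stay in the region of positive density, where maximality of [th] applies. *)
have pos : \forall e \near (0 : R), forall m, 0 < f (pert e m).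
  apply: (@filter_forall _ _ (fun m e => 0 < f (pert e m)) (nbhs (0 : R))) => m.
  have [um|/dfm dm] := eqVneq (u m) 0.
    by apply: nearW => e; rewrite /pert um mulr0 addr0.
  have : derivable (fun e : R => f (pert e m)) 0 1.
    by apply: derivable_affine_comp; rewrite mul0r addr0.
  move=> /derivable1_diffP/differentiable_continuous fc.
  by apply: (cvgr_gt _ fc); rewrite pert0.
have d0 : 'D_1 phi 0 = 0.
  apply: (@is_derive_local_max _ phi 0); first exact: derivableP.
  by near=> e; rewrite /phi pert0; apply: h; near: e.
have dphi0 : is_derive (0 : R) 1 phi 0 by apply: DeriveDef.
have dphiN : is_derive (0 : R) 1 (fun e => phi (- e)) 0.
  rewrite -[X in is_derive _ _ _ X](mul0r (-1)).
  by apply: (@is_derive1_comp _ phi -%R); rewrite oppr0.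
(* The derivative at 0 of this odd difference is computed twice: it is 0 by maximality, and
   [2 * (s i - s j)] by [phiN]. *)
have [_ d1] : is_derive (0 : R) 1 (fun e => phi e - phi (- e)) (0 - 0).
  exact: is_deriveB.
have [_ d2] : is_derive (0 : R) 1 (fun e : R => 2 * (s i - s j) * e) (2 * (s i - s j)).
  by apply: is_derive_eq; rewrite -[LHS]/(_ * 1) mulr1.
move: d2; rewrite (_ : (fun e => _) = fun e => phi e - phi (- e)).
  by rewrite d1; lra.
by apply/funext => e; rewrite phiN; ring.
Unshelve. all: by end_near. Qed.

(** Strictly ordered scores are settled by [MAP_score_le] and tied ones by [MAP_tie_eq]. For the
    converse, a reversed score order would force equal skills, hence equal scores by
    [MAP_eq_tie]. *)
Lemma MAP_order f th : log_concave f -> is_MAP kh ah delta f th ->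
  plays kh i \/ (forall th', is_MAP kh ah delta f th' -> th' = th) ->
  (s j <= s i -> th j <= th i) /\
  (derivable f (th i) 1 -> (s j <= s i <-> th j <= th i)).
Proof.
move=> fc hm hu; have hs := MAP_score_le hm.
have fwd : s j <= s i -> th j <= th i.
  rewrite le_eqVlt => /predU1P[/esym /(MAP_tie_eq fc hm hu) ->//|sji].
  by move: hs; rewrite pmulr_rge0 ?subr_gt0// subr_ge0.
split=> // df; split=> // tji; rewrite leNgt; apply/negP => sij.
move: hs; rewrite nmulr_rge0 ?subr_lt0// subr_le0 => tij.
have tE : th i = th j by apply/le_anti; rewrite tij.
by rewrite (MAP_eq_tie hm df tE) ltxx in sij.
Qed.

(** Balance kills the factor [d_tot]; neutrality kills [Gcheck]. *)
Lemma expected_score_venue_term a l z : a \in [:: i; j] ->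
  (d_tot kh a l)%:~R * Gcheck ah delta z = 0.
Proof.
move=> ha; case: hAB => [[vi vj]|vn].
  by rewrite /d_tot; move: ha; rewrite !inE => /orP[] /eqP->;
    rewrite ?vi ?vj subrr mul0r.
rewrite /Gcheck (_ : Gh _ _ _ = Ga ah delta z) ?subrr ?mul0r ?mulr0//.
by apply: eq_bigr => y _; rewrite vn.
Qed.

(** Once the opponents of [j] are relabelled by the transposition, the two equations have equal
    weights, and each argument of [Gt] is at least as large for [i]. *)
Lemma estimating_equation_le Gt gamma th : {homo Gt : x y / x < y} ->
  estimating_equation kh delta Gt (Gcheck ah delta) gamma th ->
  th j <= th i -> s j - gamma * th j <= s i - gamma * th i.
Proof.
move=> /ltW_homo Gle he tji.
have sE a : a \in [:: i; j] ->
    s a - gamma * th a = \sum_l (k_tot kh a l)%:R * Gt (th a - th l).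
  move=> ha; have kaa : k_tot kh a a = 0%N by rewrite /k_tot /ka_tot kh_tot_diag.
  rewrite -he addrK [RHS](bigD1 a) //= kaa.
  rewrite mul0r add0r; apply: eq_bigr => l _.
  by rewrite expected_score_venue_term// addr0.
rewrite !sE ?inE ?eqxx ?orbT// (reindex_inj (@perm_inj _ (tperm i j))) /=.
apply: ler_sum => l _; rewrite -{1}(tpermL i j) k_tot_tperm// ler_wpM2l//.
by apply: Gle; case: tpermP => [->|->|_ _]; lra.
Qed.

End Order.

(** The ridge term makes the weak comparison of [estimating_equation_le] strict; the forward
    direction applies it with [i] and [j] exchanged. *)
Lemma estimating_equation_order (R : realType) (M L : nat)
  (kh : 'I_L -> 'I_M -> 'I_M -> nat) (ah delta : 'I_L -> R) (i j : 'I_M)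
  (Gt : R -> R) (gamma : R) (th : 'I_M -> R) :
  no_self_match kh -> schedule_equivalent kh i j ->
  balanced_or_neutral kh ah delta i j -> 0 < gamma -> {homo Gt : x y / x < y} ->
  estimating_equation kh delta Gt (Gcheck ah delta) gamma th ->
  (score kh delta j <= score kh delta i <-> th j <= th i).
Proof.
move=> hkh hij hAB g0 hG he.
have hji : schedule_equivalent kh j i by move=> l lj li; rewrite hij.
have hBA : balanced_or_neutral kh ah delta j i.
  by case: hAB => [[]|]; [left | right].
split=> [sji|tji].
  rewrite leNgt; apply/negP => tij.
  have := estimating_equation_le hkh hji hBA hG he (ltW tij).
  have : gamma * th i < gamma * th j by rewrite ltr_pM2l.
  lra.
have := estimating_equation_le hkh hij hAB hG he tji.
have : gamma * th j <= gamma * th i by rewrite ler_pM2l.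
lra.
Qed.

(** * The Gaussian prior: log-concavity, smoothness and uniqueness of the maximizer *)

Section GaussianPrior.
Variables (R : realType) (gamma : R) (f : R -> R).
Hypotheses (gamma_gt0 : 0 < gamma) (hf : gaussian_prior gamma f).

Lemma gaussian_log_concave : log_concave f.
Proof.
case: hf => c fE; split=> [x|x y t t0 t1]; rewrite !fE ?expR_ge0//.
rewrite -!expRM -expRD ler_expR -subr_ge0.
rewrite (_ : _ - _ = gamma / 2 * (t * (1 - t) * (x - y) ^+ 2)); last by field.
have tc : 0 <= t * (1 - t) by rewrite mulr_ge0 ?subr_ge0 ?ltW.
by rewrite mulr_ge0 ?(divr_ge0 (ltW gamma_gt0))// mulr_ge0 ?sqr_ge0.
Qed.

Lemma gaussian_derivable x : derivable f x 1.
Proof.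
case: hf => c fE; rewrite (_ : f = fun x => expR (- (gamma / 2) * x ^+ 2 + c)).
  exact: ex_derive.
exact/funext.
Qed.

Variables (L : nat) (ah delta : 'I_L -> R).
Hypotheses (hL : (1 < L)%N) (hdelta : constant_sum_slopes delta).
Variables (M : nat) (kh : 'I_L -> 'I_M -> 'I_M -> nat).

(** Equality at the midpoint passes to the prior terms, whose concavity gap is gamma / 4 times the
    squared distance between the maximizers. *)
Lemma gaussian_MAP_unique th th' :
  is_MAP kh ah delta f th -> is_MAP kh ah delta f th' -> th' = th.
Proof.
move=> hm hm'; have [hmid el] := MAP_midpoint hL hdelta gaussian_log_concave hm hm'.
have h1 := hm.2 _ hmid.1; have h2 := hmid.2 _ hm.1.
have h3 := hm'.2 _ hmid.1; have h4 := hmid.2 _ hm'.1.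
rewrite /log_posterior in h1 h2 h3 h4.
have : \sum_m (gamma / 4 * (th' m - th m) ^+ 2) = 0.
  transitivity (2 * \sum_m ln (f (midpoint th th' m)) - \sum_m ln (f (th m))
                - \sum_m ln (f (th' m))); last by lra.
  rewrite mulr_sumr -!sumrB; apply: eq_bigr => m _.
  by case: hf => c fE; rewrite !fE !expRK /midpoint; field.
move=> /eqP; rewrite psumr_eq0 => [/allP h|m _]; last first.
  by rewrite mulr_ge0 ?sqr_ge0// divr_ge0// ltW.
apply/funext => m; have /h : m \in index_enum 'I_M by rewrite mem_index_enum.
by rewrite mulf_eq0 gt_eqF ?divr_gt0//= sqrf_eq0 subr_eq0 => /eqP.
Qed.

End GaussianPrior.

(** * Agreement of score order and skill order for all the estimates *)

Theorem corollary2 (R : realType) (M L : nat) (hL : (1 < L)%N)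
  (kh : 'I_L -> 'I_M -> 'I_M -> nat) (hkh : no_self_match kh)
  (delta : 'I_L -> R) (hdelta : constant_sum_slopes delta)
  (i j : 'I_M) (hij : schedule_equivalent kh i j) :
  [/\ (* Gaussian MAP estimate, any intercepts *)
      (forall ah : 'I_L -> R, balanced_or_neutral kh ah delta i j ->
       forall (gamma : R) (f : R -> R) (th : 'I_M -> R),
         0 < gamma -> gaussian_prior gamma f -> is_MAP kh ah delta f th ->
         (score kh delta j <= score kh delta i <-> th j <= th i)),
      (* (i), any strictly increasing function in the estimating equation *)
      (forall ah : 'I_L -> R, balanced_or_neutral kh ah delta i j ->
       forall (gamma : R) (Gt : R -> R) (th : 'I_M -> R),
         0 < gamma -> {homo Gt : x y / x < y} ->
         estimating_equation kh delta Gt (Gcheck ah delta) gamma th ->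
         (score kh delta j <= score kh delta i <-> th j <= th i)),
      (* (i), any home advantage in the home-boost model *)
      (forall (a : 'I_L -> R) (eta : R), symmetric_intercepts a ->
       balanced_or_neutral kh (home_boost a delta eta) delta i j ->
       forall (gamma : R) (f : R -> R) (th : 'I_M -> R),
         0 < gamma -> gaussian_prior gamma f ->
         is_MAP kh (home_boost a delta eta) delta f th ->
         (score kh delta j <= score kh delta i <-> th j <= th i)),
      (* (ii), any log-concave prior *)
      (forall ah : 'I_L -> R, balanced_or_neutral kh ah delta i j ->
       forall (f : R -> R) (th : 'I_M -> R),
         log_concave f -> is_MAP kh ah delta f th ->
         plays kh i \/ (forall th', is_MAP kh ah delta f th' -> th' = th) ->
         (score kh delta j <= score kh delta i -> th j <= th i) /\
         (derivable f (th i) 1 ->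
            (score kh delta j <= score kh delta i <-> th j <= th i)))
    & (* (iii), maximum likelihood *)
      (forall ah : 'I_L -> R, balanced_or_neutral kh ah delta i j ->
       forall th : 'I_M -> R,
         is_ML kh ah delta th -> plays kh i ->
         (score kh delta j <= score kh delta i <-> th j <= th i))].
Proof.
have gauss (ah : 'I_L -> R) : balanced_or_neutral kh ah delta i j ->
    forall (gamma : R) (f : R -> R) (th : 'I_M -> R),
      0 < gamma -> gaussian_prior gamma f -> is_MAP kh ah delta f th ->
      (score kh delta j <= score kh delta i <-> th j <= th i).
  move=> hAB gamma f th g0 hf hm.
  have hu := gaussian_MAP_unique g0 hf hL hdelta hm.
  have [_] := MAP_order hL hdelta hkh hij hAB (gaussian_log_concave g0 hf) hm
    (or_intror hu).
  by apply; exact: gaussian_derivable hf _.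
split=> //.
- by move=> ah hAB gamma Gt th; exact: estimating_equation_order.
- by move=> a eta _; exact: gauss.
- by move=> ah hAB f th; exact: MAP_order.
- move=> ah hAB th hml hp.
  (* Maximum likelihood is treated as the MAP estimate for the constant density 1, which is
     log-concave, derivable and has zero logarithm. *)
  have pE t : log_posterior kh ah delta (cst 1) t = loglik kh ah delta t.
    by rewrite /log_posterior big1 ?addr0// => m _; rewrite ln1.
  have c1 : log_concave (cst 1 : R -> R).
    by split=> [x|x y t _ _]; rewrite /= ?powR1 ?mul1r.
  have hm : is_MAP kh ah delta (cst 1) th.
    by split=> [m|t _]; [exact: ltr01 | rewrite !pE; exact: hml].
  have [_] := MAP_order hL hdelta hkh hij hAB c1 hm (or_introl hp).
  by apply; exact: derivable_cst.
Qed.
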